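(* Let $n \in \mathbb{N}$ with $n \ge 1$ and let $B = (S,D,R,C,M) \in \{0,1\}^n$ be an $n$-bit takum string. Let $\tau$ denote the takum decoding function, and let $\overline{B} = (\overline{S},\overline{D},\overline{R},\overline{C},\overline{M})$ be the string obtained from $B$ by inverting all $n$ bits. Then $$\tau\!\left(\overline{B}+1\right) = \begin{cases} -\tau(B) & \text{if } \tau(B) \neq \mathrm{NaR},\\ \mathrm{NaR} & \text{if } \tau(B) = \mathrm{NaR}.\end{cases}$$
   Context: Bit string incrementation. For $B = (B_{n-1},\dots,B_0)\in\{0,1\}^n$ (MSB to LSB) let $\mathrm{UI}(B) := \sum_{i=0}^{n-1} B_i 2^i$. Then $B+1$ is the $n$-bit string with $\mathrm{UI}(B+1) = \mathrm{UI}(B)+1$ if $\mathrm{UI}(B) \le 2^n-2$, and $B+1 := (0,\dots,0)$ if $\mathrm{UI}(B) = 2^n-1$. Takum encoding. Let $n \in \mathbb{N}$ with $n \ge 12$. An $n$-bit string, written from most significant bit (MSB) to least significant bit (LSB), is split as $(S,D,R,C,M) \in \{0,1\}^n$, where: - $S \in \{0,1\}$ is the sign bit (1 bit) and $D \in \{0,1\}$ is the direction bit (1 bit); - $R = (R_2,R_1,R_0) \in \{0,1\}^3$ are the regime bits, and the regime is $r := 7 - (4R_2 + 2R_1 + R_0)$ if $D=0$, and $r := 4R_2+2R_1+R_0$ if $D=1$, so $r \in \{0,\dots,7\}$; - $C = (C_{r-1},\dots,C_0) \in \{0,1\}^r$ are the characteristic bits, and the characteristic is $c := -2^{r+1}+1+\sum_{i=0}^{r-1}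 C_i 2^i$ if $D=0$, and $c := 2^r - 1 + \sum_{i=0}^{r-1} C_i 2^i$ if $D=1$; - $p := n-r-5 \in \{n-12,\dots,n-5\}$ is the mantissa bit count, $M = (M_{p-1},\dots,M_0) \in \{0,1\}^p$ are the mantissa bits, and $m := 2^{-p}\sum_{i=0}^{p-1} M_i 2^i \in [0,1)$ is the mantissa; - $\ell := (-1)^S (c+m)$ is the logarithmic value. The takum value is $\tau((S,D,R,C,M)) := 0$ if $S=0$ and all bits of $D,R,C,M$ are zero; $:= \mathrm{NaR}$ (''not a real'', a special non-real symbol) if $S=1$ and all bits of $D,R,C,M$ are zero; and $:= (-1)^S (\sqrt{\mathrm{e}})^{\ell}$ otherwise, where $\mathrm{e}$ is Euler's number. For $n < 12$, the value of a string is obtained by assuming the missing (least significant) bits to be zero (''ghost bits''), i.e. by appending zero bits on the LSB side until length 12; bit inversion and incrementation are performed on the $n$-bit string itself, before this extension. *)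

(* Defs.v *)
From mathcomp Require Import all_boot all_order all_algebra.
From mathcomp Require Import reals sequences exp.
Set Implicit Arguments.
Unset Strict Implicit.
Unset Printing Implicit Defensive.
Import Order.TTheory GRing.Theory Num.Theory.

Local Open Scope nat_scope.

(* Bit strings are written from MSB to LSB: the head of the sequence is the
   MSB, so the bit of weight 2 ^ i is the i-th one from the right. *)
Definition UI (s : seq bool) : nat :=
  \sum_(i < size s) nth false (rev s) i * 2 ^ i.

Definition bits_compl (n : nat) (B : n.-tuple bool) : n.-tuple bool :=
  map_tuple negb B.

(* When 0 < n, there is exactly one string to pick in the first branch
   (UI_surj, UI_inj). *)
Definition bits_incr (n : nat) (B : n.-tuple bool) : n.-tuple bool :=
  let zero : n.-tuple bool := nseq_tuple n false in
  if UI B <= 2 ^ n - 2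
  then odflt zero [pick B' : n.-tuple bool | UI B' == UI B + 1]
  else zero.

Variant takum_value (R : Type) : Type := TakumReal of R | NaR.
Arguments NaR {R}.

Section Fields.
Variable s : seq bool.

Definition sign_bit : bool := nth false s 0.
Definition direction_bit : bool := nth false s 1.
Definition regime_bits : seq bool := take 3 (drop 2 s).
Definition regime : nat :=
  if direction_bit then UI regime_bits else 7 - UI regime_bits.
Definition characteristic_bits : seq bool := take regime (drop 5 s).
Definition characteristic : int :=
  (if direction_bit then 2 ^+ regime - 1 + (UI characteristic_bits)%:Z
   else - 2 ^+ regime.+1 + 1 + (UI characteristic_bits)%:Z)%R.
Definition mantissa_bit_count : nat := size s - regime - 5.
Definition mantissa_bits : seq bool := drop (5 + regime) s.
Definition mantissa (R : realType) : R :=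
  (2 ^- mantissa_bit_count * (UI mantissa_bits)%:R)%R.
Definition logarithmic_value (R : realType) : R :=
  ((-1) ^+ sign_bit * (characteristic%:~R + mantissa R))%R.

(* Only meaningful when 12 <= size s, so that all the fields fit. *)
Definition takum_decode (R : realType) : takum_value R :=
  if all negb (behead s) then (if sign_bit then NaR else TakumReal 0%R)
  else TakumReal ((-1) ^+ sign_bit
                  * Num.sqrt (expR 1) `^ logarithmic_value R)%R.

End Fields.

(* The padding with ghost bits is empty when 12 <= n. *)
Definition takum (R : realType) (n : nat) (B : n.-tuple bool) : takum_value R :=
  takum_decode (B ++ nseq (12 - n) false) R.
Arguments takum R {n} B.

Lemma UI_cons b s : UI (b :: s) = b * 2 ^ size s + UI s.
Proof.
rewrite /UI /= big_ord_recr /= addnC; congr (_ + _).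
  by rewrite rev_cons nth_rcons size_rev ltnn eqxx.
by apply: eq_bigr => i _; rewrite rev_cons nth_rcons size_rev ltn_ord.
Qed.

Lemma UI_lt s : UI s < 2 ^ size s.
Proof.
elim: s => [|b s IHs]; first by rewrite /UI big_ord0.
rewrite UI_cons /= expnS mul2n -addnn -addnS leq_add //.
by case: b; rewrite ?mul1n.
Qed.

Lemma UI_inj s t : size s = size t -> UI s = UI t -> s = t.
Proof.
elim: s t => [|a s IHs] [|b t] //= [est]; rewrite !UI_cons est.
have := UI_lt s; have := UI_lt t; rewrite est.
case: a; case: b; rewrite ?mul1n ?mul0n ?add0n => lt_t lt_s.
- by move/addnI/(IHs _ est) ->.
- by move=> e; rewrite -e ltnNge leq_addr in lt_t.
- by move=> e; rewrite e ltnNge leq_addr in lt_s.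
- by move/(IHs _ est) ->.
Qed.

Lemma UI_surj n k : k < 2 ^ n -> exists B : n.-tuple bool, UI B = k.
Proof.
elim: n k => [|n IHn] k.
  rewrite ltnS leqn0 => /eqP->; exists [tuple].
  by rewrite /UI big_ord0.
rewrite expnS mul2n -addnn => ltk; have [lt_k|le_k] := ltnP k (2 ^ n).
  by have [B <-] := IHn _ lt_k; exists [tuple of false :: B]; rewrite UI_cons.
have [|B eB] := IHn (k - 2 ^ n); first by rewrite ltn_subLR.
by exists [tuple of true :: B]; rewrite UI_cons eB size_tuple mul1n subnKC.
Qed.

Lemma bits_incrE n (B : n.-tuple bool) :
  0 < n -> UI B <= 2 ^ n - 2 -> UI (bits_incr B) = UI B + 1.
Proof.
move=> n_gt0 leB; rewrite /bits_incr leB.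
have lt1 : 1 < 2 ^ n by rewrite -{1}(expn0 2) ltn_exp2l.
case: pickP => [B' /eqP//|noB].
have [|B' eB'] := @UI_surj n (UI B + 1).
  by rewrite addn1 -(subnK lt1) addn2 !ltnS.
by have := noB B'; rewrite eB' eqxx.
Qed.

(* Main.v *)
Require Import Defs.
From mathcomp Require Import all_boot all_order all_algebra.
From mathcomp Require Import reals sequences exp.
From mathcomp Require Import zify ring.
Set Implicit Arguments.
Unset Strict Implicit.
Unset Printing Implicit Defensive.
Import Order.TTheory GRing.Theory Num.Theory.

(** Inverting and incrementing is two's complement negation modulo [2 ^ n]. It
    flips exactly those bits that have a set bit below them, so it commutes
    with padding by ghost bits and flips the sign unless all lower bits vanish.
    With [v] the concatenation of the characteristic and mantissa bits and
    [p] the mantissa bit count, [c + m] equals [2 ^ r - 1 + UI v / 2 ^ p] when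
    [D = 1] and [- 2 ^ r.+1 + 1 + UI v / 2 ^ p] when [D = 0]. If [v] is not
    zero, negation inverts [D] and the regime bits, which preserves [r], and
    replaces [UI v] by [2 ^ (r + p) - UI v], so that [c + m] changes sign. If
    [v] is zero, then [m = 0] and the values of [D] and [R], not all zero,
    are checked directly. Hence the logarithmic value is preserved while the
    sign bit flips. *)

Local Open Scope nat_scope.

Fixpoint twos_compl (s : seq bool) : seq bool :=
  if s is b :: s' then (b (+) has id s') :: twos_compl s' else [::].

Lemma size_twos_compl s : size (twos_compl s) = size s.
Proof. by elim: s => //= b s ->. Qed.

Lemma has_twos_compl s : has id (twos_compl s) = has id s.
Proof. by elim: s => //= b s ->; case: b; case: (has id s). Qed.

(** Ghost bits are never set, so they stay zero and trigger no flip above them. *)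
Lemma twos_compl_cat_nseq s k :
  twos_compl (s ++ nseq k false) = twos_compl s ++ nseq k false.
Proof.
have has0 j : has id (nseq j false) = false by elim: j.
elim: s => [|b s IHs] /=; last by rewrite IHs has_cat has0 orbF.
by elim: k => //= k ->; rewrite has0.
Qed.

Lemma UI_nil : UI [::] = 0.
Proof. by rewrite /UI big_ord0. Qed.

Lemma UI_cat s t : UI (s ++ t) = UI s * 2 ^ size t + UI t.
Proof.
elim: s => [|b s IHs] /=; first by rewrite UI_nil.
by rewrite !UI_cons IHs size_cat expnD mulnDl mulnA addnA.
Qed.

Lemma UI_eq0 s : ~~ has id s -> UI s = 0.
Proof.
by elim: s => [|[] s IHs] //=; rewrite ?UI_nil // UI_cons => /IHs->.
Qed.

Lemma UI_map_negb s : UI (map negb s) + UI s = 2 ^ size s - 1.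
Proof.
elim: s => [|b s IHs] /=; first by rewrite UI_nil.
rewrite !UI_cons size_map expnS; have := expn_gt0 2 (size s).
by case: b => /=; lia.
Qed.

(** The sum avoids truncated subtraction; a zero string is left unchanged, hence the value 0. *)
Lemma UI_twos_compl s :
  UI (twos_compl s) + UI s = if has id s then 2 ^ size s else 0.
Proof.
elim: s => [|b s IHs] /=; first by rewrite UI_nil.
rewrite !UI_cons size_twos_compl expnS.
by case: b; move: IHs; case: (has id s) => /=; lia.
Qed.

Lemma bits_incr_compl n (B : n.-tuple bool) :
  0 < n -> bits_incr (bits_compl B) = twos_compl B :> seq bool.
Proof.
move=> n_gt0; apply: UI_inj; first by rewrite size_twos_compl !size_tuple.
have := UI_twos_compl B; have := UI_map_negb B; rewrite size_tuple.
have two_le : 2 <= 2 ^ n by rewrite -{1}(expn1 2) leq_exp2l.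
have [le_compl|lt_compl] := leqP (UI (bits_compl B)) (2 ^ n - 2).
  rewrite bits_incrE //= => eC.
  have -> : has id B by apply: contraLR le_compl => /UI_eq0; rewrite /=; lia.
  by lia.
(* Overflow: the complement is all ones, so [B] is zero and both sides are the zero string. *)
rewrite /bits_incr leqNgt lt_compl /= => eC.
have eB : UI B = 0 by move: lt_compl; rewrite /=; lia.
rewrite eB addn0 (@UI_eq0 (nseq n false)); last by elim: (n).
have := UI_lt (twos_compl B); rewrite size_twos_compl size_tuple.
by case: ifP => // _; lia.
Qed.

Local Open Scope ring_scope.

Definition unsigned_log_value (R : realType) (s : seq bool) : R :=
  (characteristic s)%:~R + mantissa s R.

(** Guarantees that all fields fit into 12 bits, so that the subtraction in [mantissa_bit_count] is
    exact. *)
Lemma regime_le7 s : (regime s <= 7)%N.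
Proof.
rewrite /regime; case: ifP => _; last exact: leq_subr.
rewrite -ltnS; apply: leq_trans (UI_lt _) _.
rewrite (_ : 8 = 2 ^ 3)%N // leq_exp2l // /regime_bits size_take.
by case: ltnP.
Qed.

(** Characteristic and mantissa bits are adjacent, so together they form one fixed-point number with
    [mantissa_bit_count s] fractional bits. *)
Lemma unsigned_log_valueE (R : realType) s : (12 <= size s)%N ->
  unsigned_log_value R s =
    (if direction_bit s then 2 ^+ regime s - 1 else - 2 ^+ (regime s).+1 + 1)
    + (UI (drop 5 s))%:R / 2 ^+ mantissa_bit_count s.
Proof.
move=> s_ge12; have r_le7 := regime_le7 s.
have szM : size (mantissa_bits s) = mantissa_bit_count s.
  by rewrite /mantissa_bits /mantissa_bit_count size_drop; lia.
have -> : drop 5 s = characteristic_bits s ++ mantissa_bits s.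
  by rewrite /mantissa_bits addnC -drop_drop cat_take_drop.
rewrite /unsigned_log_value /mantissa /characteristic UI_cat szM.
rewrite natrD natrM natrX.
have n0 : 2 ^+ mantissa_bit_count s != 0 :> R by rewrite expf_neq0 ?pnatr_eq0.
rewrite mulrDl mulfK // addrA [2 ^- _ * _]mulrC; congr (_ + _).
by case: ifP => _; rewrite !rmorphD /= ?rmorphN /= rmorphXn.
Qed.

Lemma unsigned_log_value_twos_compl (R : realType) s :
    (12 <= size s)%N -> has id (behead s) ->
  unsigned_log_value R (twos_compl s) = - unsigned_log_value R s.
Proof.
move=> s_ge12 nz; rewrite !unsigned_log_valueE ?size_twos_compl //.
rewrite /mantissa_bit_count size_twos_compl.
have := regime_le7 s.
case: s s_ge12 nz => [|a [|d [|r2 [|r1 [|r0 v]]]]] //= v_ge7 nz.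
rewrite /direction_bit /= !drop0.
have := UI_twos_compl v.
case: (boolP (has id v)) nz => [_ _ | _ nz eUI _].
  rewrite !orbT !addbT => eUI.
  (* Inverting [d] switches between reading the regime bits as [k] and as [7 - k], which undoes
     their inversion. *)
  have -> x w : regime [:: x, ~~ d, ~~ r2, ~~ r1, ~~ r0 & w] =
      regime [:: a, d, r2, r1, r0 & v].
    rewrite /regime /regime_bits /direction_bit /= !take0 !UI_cons UI_nil.
    by case: d; case: r2; case: r1; case: r0.
  move: (regime _) => r r_le7; set p := (_ - r - 5)%N.
  have szv : size v = (r + p)%N by rewrite /p; lia.
  have n0 : 2 ^+ p != 0 :> R by rewrite expf_neq0 ?pnatr_eq0.
  have eUI' : (UI (twos_compl v))%:R = 2 ^+ r * 2 ^+ p - (UI v)%:R :> R.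
    by rewrite -exprD -szv -natrX -eUI natrD addrK.
  by rewrite eUI' !exprS; case: d => /=; field.
have [-> ->] : UI (twos_compl v) = 0%N /\ UI v = 0%N by lia.
(* Negation now exchanges [D = 1] with regime [r > 0] and [D = 0] with regime [r - 1], of values
   [2 ^ r - 1] and [- 2 ^ r + 1]; it fixes [D = 1] with [r = 0], of value 0. *)
rewrite !mul0r !addr0 /regime /regime_bits /direction_bit /= !take0.
rewrite !UI_cons UI_nil; move: nz.
by case: d; case: r2; case: r1; case: r0 => //= _; ring.
Qed.

Lemma takum_decode_twos_compl (R : realType) s : (12 <= size s)%N ->
  takum_decode (twos_compl s) R =
    match takum_decode s R with
    | TakumReal x => TakumReal (- x)
    | NaR => NaR
    end.
Proof.
move=> s_ge12; have all_negb t : all negb t = ~~ has id t.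
  by rewrite -all_predC.
rewrite /takum_decode /logarithmic_value !all_negb.
have := @unsigned_log_value_twos_compl R s s_ge12; rewrite /unsigned_log_value.
case: s s_ge12 => //= b s _; rewrite has_twos_compl.
rewrite /sign_bit /=; case: (has id s) => /= [/(_ isT) -> | _].
  by rewrite addbT signrN mulrNN mulNr.
(* The strings of NaR and 0 are their own negatives. *)
by rewrite addbF; case: b; rewrite ?oppr0.
Qed.

Theorem proposition6 (R : realType) (n : nat) (n_gt0 : (1 <= n)%N)
    (B : n.-tuple bool) :
  takum R (bits_incr (bits_compl B)) =
    match takum R B with
    | TakumReal x => TakumReal (- x)%R
    | NaR => NaR
    end.
Proof.
rewrite /takum bits_incr_compl // -twos_compl_cat_nseq.
apply: takum_decode_twos_compl.
by rewrite size_cat size_tuple size_nseq; lia.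
Qed.
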